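(* Let $\mathtt P\in\widetilde{\mathcal A}$ and let $k\ge2$ be an integer such that the tilted $(k-1)$-orbit $\widetilde{\mathrm{Orbit}}{}^{(k-1)}(\mathtt P)$ distills the $\mathtt{CHSH}$-value. Then the highest $\mathtt{CHSH}$-value over $\widetilde{\mathrm{Orbit}}{}^{(k)}(\mathtt P)$ is achieved at the product of $k$ copies of $\mathtt P$ on the right: $$\mathtt P^{\boxtimes k}:=\Big(\big((\mathtt P\boxtimes\mathtt P)\boxtimes\mathtt P\big)\cdots\Big)\boxtimes\mathtt P\ \in\ \underset{\mathtt Q\in\widetilde{\mathrm{Orbit}}{}^{(k)}(\mathtt P)}{\mathrm{argmax}}\ \mathtt{CHSH}(\mathtt Q).$$
   Context: Boxes are elements of the real vector space $\mathcal B$ of functions $\{0,1\}^4\to\mathbb R$, written $\mathtt P(a,b\,|\,x,y)$. Define $\mathtt{PR}(a,b|x,y)=\frac12\mathbf 1_{a\oplus b=xy}$, $\mathtt{SR}(a,b|x,y)=\frac12\mathbf 1_{a=b}$, $\mathtt I(a,b|x,y)=\frac14$, where $\oplus$ is addition mod 2. The $\mathtt{CHSH}$-value of a box is $\mathtt{CHSH}(\mathtt P)=\frac14\sum_{a,b,x,y:\,a\oplus b=xy}\mathtt P(a,b|x,y)$. Let $\widetilde{\mathcal A}$ be the set of boxes $\mathtt P$ in the convex hull $\mathrm{Conv}\{\mathtt{PR},\mathtt{SR},\mathtt I\}$ with $\mathtt{CHSH}(\mathtt P)\ge\frac34$. The product $\boxtimes$ (induced by the wiring $\mathsf W_{\mathrm{BS}}$)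 is the bilinear operation $$\mathtt P\boxtimes\mathtt Q(a,b|x,y)=\sum_{a_1,a_2,b_1,b_2\in\{0,1\}}\mathtt P(a_1,b_1|x,y)\,\mathtt Q(a_2,b_2|xa_1,yb_1)\,\mathbf 1_{a=a_1\oplus a_2}\mathbf 1_{b=b_1\oplus b_2},$$ which is neither commutative nor associative. $\mathtt P^{\boxtimes 1}=\mathtt P$ and $\mathtt P^{\boxtimes (k+1)}=\mathtt P^{\boxtimes k}\boxtimes\mathtt P$. The tilted $k$-orbits are defined by $\widetilde{\mathrm{Orbit}}{}^{(1)}(\mathtt P)=\{\mathtt P\}$ and, for $k\ge2$, $\widetilde{\mathrm{Orbit}}{}^{(k)}(\mathtt P)=\{\mathtt P\boxtimes\mathtt Q:\mathtt Q\in\widetilde{\mathrm{Orbit}}{}^{(k-1)}(\mathtt P)\}\cup\{\mathtt Q\boxtimes\mathtt P:\mathtt Q\in\widetilde{\mathrm{Orbit}}{}^{(k-1)}(\mathtt P)\}$. A tilted $j$-orbit of $\mathtt P$ distills the $\mathtt{CHSH}$-value if it contains a box $\mathtt Q$ with $\mathtt{CHSH}(\mathtt Q)\ge\mathtt{CHSH}(\mathtt P)$. *)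

(* Defs.v *)
From mathcomp Require Import all_boot all_order all_algebra.
From mathcomp Require Import all_classical reals convex.

Set Implicit Arguments.
Unset Strict Implicit.
Unset Printing Implicit Defensive.

Import Order.TTheory GRing.Theory Num.Theory.

Local Open Scope classical_set_scope.
Local Open Scope ring_scope.

(* Bits are booleans: addition mod 2 is [(+)] and multiplication is [&&].
   The value P(a, b | x, y) is written [P (a, b, x, y)]. The codomain is [R^o]
   so that boxes form an [lmodType R]. *)
Definition box (R : realType) := {ffun bool * bool * bool * bool -> R^o}.

Definition PR (R : realType) : box R :=
  [ffun t => let: (a, b, x, y) := t in
     (2^-1 : R) * (a (+) b == x && y)%:R].

Definition SR (R : realType) : box R :=
  [ffun t => let: (a, b, x, y) := t in (2^-1 : R) * (a == b)%:R].

Definition Ibox (R : realType) : box R := [ffun => 4^-1 : R].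

Definition CHSH (R : realType) (P : box R) : R :=
  4^-1 * \sum_(a : bool) \sum_(b : bool) \sum_(x : bool)
           \sum_(y : bool | a (+) b == x && y) (P (a, b, x, y) : R).

Definition convex_hull (R : realType) (E : lmodType R) (A : set E) : set E :=
  smallest (@convex_set R E) A.

Definition tilted_A (R : realType) : set (box R) :=
  [set P | convex_hull [set PR R; SR R; Ibox R] P /\ 3 / 4 <= CHSH P].

Definition boxprod (R : realType) (P Q : box R) : box R :=
  [ffun t => let: (a, b, x, y) := t in
     \sum_(a1 : bool) \sum_(a2 : bool) \sum_(b1 : bool) \sum_(b2 : bool)
       (P (a1, b1, x, y) : R) * Q (a2, b2, x && a1, y && b1)
         * (a == a1 (+) a2)%:R * (b == b1 (+) b2)%:R].

Notation "P ⊠ Q" := (boxprod P Q) (at level 40, left associativity).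

(* The power and the orbits are only meaningful for [1 <= k]; at the junk
   index 0 they take the same value as at 1. *)
Definition boxpow (R : realType) (P : box R) (k : nat) : box R :=
  iter k.-1 (fun Q => Q ⊠ P) P.

Definition tilted_orbit (R : realType) (k : nat) (P : box R) : set (box R) :=
  iter k.-1
    (fun O : set (box R) => [set P ⊠ Q | Q in O] `|` [set Q ⊠ P | Q in O])
    [set P].

Definition orbit_distills (R : realType) (j : nat) (P : box R) : Prop :=
  exists2 Q, tilted_orbit j P Q & CHSH P <= CHSH Q.

Definition argmax (R : realType) (T : Type) (A : set T) (f : T -> R) : set T :=
  [set x | A x /\ forall y, A y -> f y <= f x].

(* Main.v *)
Require Import Defs.
From mathcomp Require Import all_boot all_order all_algebra.
From mathcomp Require Import all_classical reals.
From mathcomp Require Import interval_inference convex ring lra.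

(** Every box in the plane spanned by PR, SR and I has uniform marginals, so it
    is given by two correlators: [u] on the inputs with [x && y = false] and
    [v] on [x = y = true].  In these coordinates [CHSH] is [1/2 + (3u - v)/8],
    and the product multiplies the first coordinates.  Hence all boxes of the
    k-orbit of [P = (u, v)] share the first coordinate [u ^+ k], and maximising
    [CHSH] means minimising the second one.  Left and right multiplication by
    [P] act on it by two increasing affine maps; below the threshold at which
    the CHSH-value of [P] is reached, the right one gives the smaller result.
    It remains to see that distillation at step [k] implies distillation at all
    earlier steps: if right multiplication lifts one threshold above the next
    one, then it does so at all later steps, so that distillation never
    resumes once it is lost. *)

Set Implicit Arguments.
Unset Strict Implicit.
Unset Printing Implicit Defensive.

Import Order.TTheory GRing.Theory Num.Theory.

Local Open Scope classical_set_scope.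
Local Open Scope ring_scope.

Section CorrelatorBoxes.
Variable R : realType.
Implicit Types (u v : R) (P Q : box R).

Definition corr_box u v : box R :=
  [ffun t => let: (a, b, x, y) := t in
     4^-1 * (1 + (-1) ^+ (a (+) b) * (if x && y then v else u))].

(** At x = y = 1 the first box outputs (1, 1) with weight (1 + v) / 4, and only then is the second
    box read on inputs (1, 1). *)
Definition corr_prod v u' v' : R := ((1 + v) * v' + (3 * v - 1) * u') / 4.

Lemma CHSH_corr_box u v : CHSH (corr_box u v) = 2^-1 + (3 * u - v) / 8.
Proof.
have sum_cond (p : pred bool) (f : bool -> R) : \sum_(y | p y) f y =
    (if p true then f true else 0) + (if p false then f false else 0).
  by rewrite big_mkcond big_bool.
by rewrite /CHSH !big_bool !sum_cond /= !ffunE /= ?(expr0, expr1); field.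
Qed.

Lemma boxprod_corr u v u' v' :
  corr_box u v ⊠ corr_box u' v' = corr_box (u * u') (corr_prod v u' v').
Proof.
apply/ffunP => -[[[a b] x] y]; rewrite !ffunE !big_bool /= !ffunE /=.
rewrite /corr_prod.
by case: a; case: b; case: x; case: y; rewrite /= ?(expr0, expr1); field.
Qed.

Lemma PR_corr : PR R = corr_box 1 (-1).
Proof.
apply/ffunP => -[[[a b] x] y]; rewrite !ffunE.
by case: a; case: b; case: x; case: y; rewrite /= ?(expr0, expr1); field.
Qed.

Lemma SR_corr : SR R = corr_box 1 1.
Proof.
apply/ffunP => -[[[a b] x] y]; rewrite !ffunE.
by case: a; case: b; case: x; case: y; rewrite /= ?(expr0, expr1); field.
Qed.

Lemma Ibox_corr : Ibox R = corr_box 0 0.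
Proof.
apply/ffunP => -[[[a b] x] y]; rewrite !ffunE.
by case: (x && y); rewrite mulr0 addr0 mulr1.
Qed.

Lemma conv_corr_box (l : R) u v u' v' :
  l *: corr_box u v + (1 - l) *: corr_box u' v' =
  corr_box (l * u + (1 - l) * u') (l * v + (1 - l) * v').
Proof.
apply/ffunP => -[[[a b] x] y]; rewrite !ffunE /= /GRing.scale /=.
by case: (x && y); ring.
Qed.

(** The triangle with vertices [PR], [SR] and [Ibox], cut out in the (u, v) plane. *)
Definition triangle : set (box R) :=
  [set Q | exists u v, [/\ Q = corr_box u v, - u <= v, v <= u & u <= 1]].

Lemma triangle_convex : @convex_set R (box R) triangle.
Proof.
move=> P Q l /set_mem[u [v [-> vu1 vu2 u1]]] /set_mem[u' [v' [-> v'u1 v'u2 u'1]]].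
apply/mem_set; have l0 : 0 <= l%:num by [].
have l1 : l%:num <= 1 by [].
exists (l%:num * u + (1 - l%:num) * u'), (l%:num * v + (1 - l%:num) * v').
by split; [exact: conv_corr_box | nra..].
Qed.

Lemma tilted_A_corr P : tilted_A P ->
  exists u v, P = corr_box u v /\
    [/\ - u <= v, v <= u, u <= 1 & 2 <= 3 * u - v].
Proof.
move=> [hullP chshP].
have [u [v [Pe vu1 vu2 u1]]] : triangle P.
  apply: hullP; split; first exact: triangle_convex.
  move=> Q /= [[->|->]|->]; rewrite ?PR_corr ?SR_corr ?Ibox_corr.
  - by exists 1, (-1); split => //; lra.
  - by exists 1, 1; split => //; lra.
  - by exists 0, 0; split => //; lra.
exists u, v; split => //; split => //.
by move: chshP; rewrite Pe CHSH_corr_box; lra.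
Qed.

End CorrelatorBoxes.

Section OrbitCorrelators.
Variables (R : realType) (u v : R).

(* Index [n] stands for the [n.+1]-orbit, here and below. *)
Fixpoint orbit_corr (n : nat) : set R :=
  if n is m.+1 then
    [set corr_prod v (u ^+ n) w | w in orbit_corr m] `|`
    [set corr_prod w u v | w in orbit_corr m]
  else [set v].

Lemma tilted_orbit_corr n :
  tilted_orbit n.+1 (corr_box u v) `<=`
  [set corr_box (u ^+ n.+1) w | w in orbit_corr n].
Proof.
elim: n => [|n IHn] Q /=; first by move=> ->; exists v.
move=> [] [Q' /IHn[w nw <-] <-]; rewrite boxprod_corr.
- by exists (corr_prod v (u ^+ n.+1) w); rewrite -?exprS//; left; exists w.
- by exists (corr_prod w u v); rewrite -?exprSr//; right; exists w.
Qed.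

Lemma boxpow_corr n : boxpow (corr_box u v) n.+1 =
  corr_box (u ^+ n.+1) (iter n (fun w => corr_prod w u v) v).
Proof.
elim: n => [|n IHn] //.
by rewrite /boxpow /= in IHn *; rewrite IHn boxprod_corr -exprSr.
Qed.

Hypothesis uvP : [/\ - u <= v, v <= u, u <= 1 & 2 <= 3 * u - v].

Let uge0 : 0 <= u. Proof. have [? ? ? ?] := uvP; lra. Qed.

Let expu_le n : u ^+ n.+1 <= u.
Proof. by have [_ _ ? _] := uvP; rewrite exprS ler_piMr// exprn_ile1. Qed.

(* [w <= threshold n] iff the box [(u ^+ n.+1, w)] has at least the CHSH-value
   of [(u, v)]. *)
Definition threshold (n : nat) : R := v - 3 * u + 3 * u ^+ n.+1.

Definition distills (n : nat) : Prop :=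
  exists2 w, orbit_corr n w & w <= threshold n.

Lemma right_le_left n w : w <= threshold n ->
  corr_prod w u v <= corr_prod v (u ^+ n.+1) w.
Proof.
have [? ? ? ?] := uvP; rewrite /threshold /corr_prod; have := expu_le n.
move: (u ^+ n.+1) => t tu wt.
(* The difference of the two sides is a quarter of the sum of these products. *)
have h1 : 0 <= (v - 3 * u + 3 * t - w) * (3 * u - 1) by apply: mulr_ge0; lra.
have h2 : 0 <= (9 * u - 2 - 3 * v) * (u - t) by apply: mulr_ge0; lra.
lra.
Qed.

Lemma right_mono : {homo (fun w => corr_prod w u v) : w w' / w <= w'}.
Proof.
have [? ? ? ?] := uvP => w w' ww'; rewrite /corr_prod.
have : 0 <= (w' - w) * (v + 3 * u) by apply: mulr_ge0; lra.
lra.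
Qed.

Lemma left_mono t : {homo corr_prod v t : w w' / w <= w'}.
Proof.
have [? ? ? ?] := uvP => w w' ww'; rewrite /corr_prod.
have : 0 <= (w' - w) * (1 + v) by apply: mulr_ge0; lra.
lra.
Qed.

Definition right_exceeds (n : nat) : Prop :=
  threshold n.+1 < corr_prod (threshold n) u v.

(** The excess is affine in u^(n+1) with slope 3(v - u)/4 <= 0, and the powers of u decrease. *)
Lemma right_exceeds_mono m n : (m <= n)%N -> right_exceeds m -> right_exceeds n.
Proof.
have [? ? ? ?] := uvP; rewrite /right_exceeds /threshold /corr_prod => mn.
have : u ^+ n.+1 <= u ^+ m.+1 by apply: ler_wiXn2l.
rewrite (exprS u m.+1) (exprS u n.+1).
move: (u ^+ m.+1) (u ^+ n.+1) => s t ts.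
have : 0 <= (u - v) * (s - t) by apply: mulr_ge0; lra.
lra.
Qed.

Lemma distills_pred n : distills n.+1 -> distills n.
Proof.
move=> dn; have [exc|nexc] := pselect (right_exceeds n).
  (* Were w above its threshold, either product would land above the next one. *)
  have [_ [] [w nw <-] wt] := dn; exists w => //; rewrite leNgt;
    apply/negP => /ltW tw.
  - have := le_lt_trans (le_trans (left_mono _ tw) wt) exc.
    by rewrite ltNge right_le_left.
  - by have := le_lt_trans (le_trans (right_mono tw) wt) exc; rewrite ltxx.
(* No excess at n means none before, so right powers started at v = [threshold 0] stay below the
   thresholds up to n. *)
suff: forall i, (i <= n)%N -> distills i by exact.
elim=> [|i IHi] ilen; first by exists v => //; rewrite /threshold expr1; lra.
have [w iw wt] := IHi (ltnW ilen).
exists (corr_prod w u v); first by right; exists w.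
apply: le_trans (right_mono wt) _; rewrite leNgt; apply/negP => exc.
by apply: nexc; exact: right_exceeds_mono (ltnW ilen) exc.
Qed.

Lemma iter_right_min n w : distills n -> orbit_corr n.+1 w ->
  iter n.+1 (fun w => corr_prod w u v) v <= w.
Proof.
elim: n w => [|n IHn] w dn; first by move=> [] [_ -> <-].
have min_n := IHn _ (distills_pred dn).
have [w0 nw0 w0t] := dn; set m := iter n.+1 _ v in min_n.
move=> [] [w' nw' <-]; rewrite iterS -/m; last exact/right_mono/min_n.
(* The minimum m lies below the threshold because w0 does, so its right product is at most its left
   one. *)
apply: le_trans (left_mono _ (min_n _ nw')).
exact/right_le_left/(le_trans (min_n _ nw0)).
Qed.

End OrbitCorrelators.

Lemma boxpow_tilted_orbit (R : realType) (P : box R) (n : nat) :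
  tilted_orbit n.+1 P (boxpow P n.+1).
Proof. by elim: n => [|n IHn] //; right; exists (boxpow P n.+1). Qed.

Theorem theorem13 (R : realType) (P : box R) (k : nat)
    (hP : tilted_A P) (hk : (2 <= k)%N)
    (hdist : orbit_distills k.-1 P) :
  argmax (tilted_orbit k P) (@CHSH R) (boxpow P k).
Proof.
case: k hk hdist => [|[|n]]// _ [Q orbQ]; have [u [v [Pe]]] := tilted_A_corr hP.
move: orbQ; rewrite {hP P}Pe => orbQ uvP PQ.
split=> [|Q' /tilted_orbit_corr[w nw <-]]; first exact: boxpow_tilted_orbit.
have dn : distills u v n.
  have [w' nw' Qe] := tilted_orbit_corr orbQ; exists w' => //.
  by move: PQ; rewrite -Qe !CHSH_corr_box /threshold; lra.
have := iter_right_min uvP dn nw.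
by rewrite boxpow_corr !CHSH_corr_box; lra.
Qed.
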